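(* Let $h(t)=\sum_{k=0}^n h_k t^k$ be a reciprocal polynomial of degree $n$, and let $\gamma(u)=\sum_{m\ge 0}\gamma_m u^m$ be its gamma polynomial, i.e. the unique polynomial of degree at most $\lfloor n/2\rfloor$ such that $h(t)=(1+t)^n\,\gamma\!\left(\frac{t}{(1+t)^2}\right)$. Then for every integer $m\ge 0$, $$\gamma_m=\sum_{i=0}^m\sum_{\ell=0}^{i} h_\ell\binom{-n}{i-\ell}\sum_{\substack{j_1+\cdots+j_i=m\\ j_1,\dots,j_i\ge 0}}\widetilde C_{j_1}\cdots\widetilde C_{j_i} =\sum_{i=0}^m\sum_{\ell=0}^{i} h_\ell(-1)^{i-\ell}\binom{n+i-\ell-1}{i-\ell}\sum_{\substack{j_1+\cdots+j_i=m\\ j_1,\dots,j_i\ge 0}}\widetilde C_{j_1}\cdots\widetilde C_{j_i},$$ where $\widetilde C_0=0$ and, for $k\ge 1$, $\widetilde C_k$ is the $k$-th Catalan number. In particular, this sum equals $0$ for $m>\lfloor n/2\rfloor$.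
   Context: A polynomial $h(t)=\sum_{k=0}^n h_kt^k$ of degree $n$ (with, say, real coefficients) is reciprocal if $t^nh(1/t)=h(t)$, i.e. $h_k=h_{n-k}$ for all $k$. For such $h$ a unique polynomial $\gamma$ of degree at most $\lfloor n/2\rfloor$ with $h(t)=(1+t)^n\gamma(t/(1+t)^2)$ exists. The Catalan numbers are $C_k=\frac{1}{k+1}\binom{2k}{k}$. Binomial coefficients are generalized: $\binom{x}{k}=x(x-1)\cdots(x-k+1)/k!$, with $\binom{x}{0}=1$. Conventions: $h_\ell=0$ for $\ell>n$; for $i=0$ the innermost sum is $1$ if $m=0$ (empty product) and $0$ if $m>0$. *)

(* Defs.v *)
From mathcomp Require Import all_boot all_order all_algebra.
Set Implicit Arguments.
Unset Strict Implicit.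
Unset Printing Implicit Defensive.
Import GRing.Theory Num.Theory.
Local Open Scope ring_scope.

Definition gbinom (F : fieldType) (x : F) (k : nat) : F :=
  (\prod_(a < k) (x - a%:R)) / k`!%:R.

Definition reciprocal (F : fieldType) (n : nat) (h : {poly F}) : Prop :=
  size h = n.+1 /\ forall k : nat, (k <= n)%N -> h`_k = h`_(n - k).

(* The identity h(t) = (1+t)^n g(t/(1+t)^2) is read in the field of rational
   functions in t, the coefficients of g being embedded as constants. *)
Definition is_gamma_poly (F : fieldType) (n : nat) (h g : {poly F}) : Prop :=
  (size g <= (n %/ 2).+1)%N /\
  tofrac h =
    tofrac (1 + 'X) ^+ n *
    (map_poly (fun c : F => tofrac c%:P) g).[tofrac 'X / tofrac (1 + 'X) ^+ 2].

Definition catalan (F : fieldType) (k : nat) : F :=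
  (k.+1%:R)^-1 * 'C(2 * k, k)%:R.

Definition catalan0 (F : fieldType) (k : nat) : F :=
  if k == 0%N then 0 else catalan F k.

(* The indices j_a of a family of naturals summing to m are at most m, so they
   range over 'I_m.+1; for i = 0 there is exactly one (empty) family. *)
Definition catalan0_conv (F : fieldType) (i m : nat) : F :=
  \sum_(j : {ffun 'I_i -> 'I_m.+1} | (\sum_(a < i) j a)%N == m)
    \prod_(a < i) catalan0 F (j a).

(* Main.v *)
(** Substitute [t = c(u)] in [h(t) = (1 + t)^n gamma(t / (1 + t)^2)], where
    [c(u)] is the generating series of the shifted Catalan numbers. The Catalan
    recursion says [c = u (1 + c)^2], so the argument of [gamma] becomes [u] and
    [gamma(u) = h(c(u)) (1 + c(u))^(-n)]; now compare the coefficients of [u^m].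
    Series are replaced by polynomials agreeing up to degree [m]. Both the
    expansion of [(1 + t)^(-n)] and the Catalan recursion, via
    [C_k = 2 (-4)^k binom(1/2, k+1)], come from the Vandermonde convolution. *)
Require Import Defs.
From mathcomp Require Import all_boot all_order all_algebra.
From mathcomp Require Import ring.
Set Implicit Arguments.
Unset Strict Implicit.
Unset Printing Implicit Defensive.
Import GRing.Theory Num.Theory.
Local Open Scope ring_scope.

Lemma expr_split (R : pzSemiRingType) (x : R) a n :
  (a <= n)%N -> x ^+ n = x ^+ a * x ^+ (n - a).
Proof. by move=> le_an; rewrite -exprD subnKC. Qed.

Lemma gbinom0 (F : fieldType) (x : F) : gbinom x 0 = 1.
Proof. by rewrite /gbinom big_ord0 fact0 divr1. Qed.

Lemma gbinomS (F : numFieldType) (x : F) k :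
  k.+1%:R * gbinom x k.+1 = (x - k%:R) * gbinom x k.
Proof.
rewrite /gbinom big_ord_recr /= factS natrM.
have k1 : k.+1%:R != 0 :> F by rewrite pnatr_eq0.
have kf : k`!%:R != 0 :> F by rewrite pnatr_eq0 -lt0n fact_gt0.
by field; rewrite kf nat1r.
Qed.

Lemma gbinom_nat (F : numFieldType) n k : gbinom n%:R k = 'C(n, k)%:R :> F.
Proof.
elim: k => [|k IH]; first by rewrite gbinom0 bin0.
have k1 : k.+1%:R != 0 :> F by rewrite pnatr_eq0.
apply: (mulfI k1); rewrite gbinomS IH -natrM mul_bin_left natrM.
have [le_kn|lt_nk] := leqP k n; first by rewrite natrB.
by rewrite bin_small // !mulr0.
Qed.

(** Reading the product backwards matches the factors one by one: -x - (k-1-a) = -((x+k-1) - a). *)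
Lemma gbinomN (F : fieldType) (x : F) k :
  gbinom (- x) k = (-1) ^+ k * gbinom (x + k%:R - 1) k.
Proof.
rewrite /gbinom mulrA; congr (_ / _).
rewrite -[in (-1) ^+ k](card_ord k) -prodr_const -big_split /=.
rewrite [LHS](reindex_inj rev_ord_inj) /=; apply: eq_bigr => a _.
by rewrite natrB // -natr1; ring.
Qed.

(** Vandermonde convolution, by induction on [k]. Multiplied by k+1 = a + (k+1-a), each summand
    splits in two, and [gbinomS] lowers one index in each half. After a shift the weights add up to
    (x-a) + (y-(k-a)) = x+y-k. *)
Lemma gbinomD (F : numFieldType) (x y : F) k :
  gbinom (x + y) k = \sum_(a < k.+1) gbinom x a * gbinom y (k - a).
Proof.
elim: k => [|k IH]; first by rewrite big_ord1 !gbinom0 mulr1.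
have k1 : k.+1%:R != 0 :> F by rewrite pnatr_eq0.
apply: (mulfI k1); rewrite gbinomS {}IH.
have -> : k.+1%:R * (\sum_(a < k.+2) gbinom x a * gbinom y (k.+1 - a)) =
    \sum_(a < k.+2) a%:R * gbinom x a * gbinom y (k.+1 - a) +
    \sum_(a < k.+2) gbinom x a * ((k.+1 - a)%:R * gbinom y (k.+1 - a)).
  rewrite mulr_sumr -big_split /=; apply: eq_bigr => a _.
  by rewrite natrB -1?ltnS //; ring.
rewrite [X in _ = X + _]big_ord_recl mulr0n !mul0r add0r.
rewrite [X in _ = _ + X]big_ord_recr /= subnn mul0r mulr0 addr0.
rewrite mulr_sumr -big_split /=; apply: eq_bigr => a _.
have le_ak : (a <= k)%N by rewrite -ltnS.
by rewrite /bump /= add1n subSS gbinomS subSn // gbinomS natrB //; ring.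
Qed.

(** These are the coefficients of (1 - sqrt(1-4u))/(2u). Both sides equal 1 at k = 0 and satisfy
    (k+2) C_(k+1) = 2(2k+1) C_k. *)
Lemma catalan_gbinom (F : numFieldType) k :
  catalan F k = 2 * (-4) ^+ k * gbinom (2^-1) k.+1.
Proof.
have two0 : 2 != 0 :> F by rewrite pnatr_eq0.
elim: k => [|k IH].
  have := gbinomS (2^-1 : F) 0; rewrite gbinom0 mul1r => ->.
  by rewrite /catalan muln0 bin0 invr1 expr0 !mulr1 subr0 divff.
have k1 : k.+1%:R != 0 :> F by rewrite pnatr_eq0.
have k2 : k.+2%:R != 0 :> F by rewrite pnatr_eq0.
have step : k.+2%:R * catalan F k.+1 = 2 * (2 * k%:R + 1) * catalan F k.
  rewrite /catalan mulVKf //; apply: (mulfI k1).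
  rewrite [RHS]mulrCA mulVKf //.
  have nat_step : (k.+1 * 'C(2 * k.+1, k.+1) = 2 * (2 * k + 1) * 'C(2 * k, k))%N.
    have -> : (2 * k.+1 = (2 * k).+2)%N by rewrite mulnS.
    rewrite -mul_bin_diag /=.
    have e : (k.+1 * 'C((2 * k).+1, k) = (2 * k).+1 * 'C(2 * k, k))%N.
      have := mul_bin_down (2 * k).+1 k => /=.
      by rewrite subSn mul2n -addnn ?leq_addr // addnK.
    have -> : ((2 * k).+2 = 2 * k.+1)%N by rewrite mulnS.
    by rewrite -mulnA e addn1 mulnA.
  by rewrite -[LHS]natrM nat_step !natrM natrD natrM.
apply: (mulfI k2); rewrite step {}IH [RHS]mulrCA gbinomS.
by rewrite exprS -natr1; field.
Qed.

(** The square of sqrt(1-4u) is linear: Vandermonde at 1/2 + 1/2 gives binom(1, k+2) = 0. The two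
    end terms of that convolution yield C_(k+1), the inner ones the products C_a C_(k-a). *)
Lemma catalanS (F : numFieldType) k :
  catalan F k.+1 = \sum_(a < k.+1) catalan F a * catalan F (k - a).
Proof.
have : gbinom (2^-1 + 2^-1 : F) k.+2 = 0.
  have -> : 2^-1 + 2^-1 = 1%:R :> F by field.
  by rewrite gbinom_nat bin_small.
rewrite gbinomD big_ord_recl big_ord_recr /= gbinom0 subnn gbinom0.
rewrite mul1r mulr1 subn0 => e0.
have e1 : gbinom (2^-1) k.+2 *+ 2 = - \sum_(a < k.+1) gbinom (2^-1 : F) a.+1 *
    gbinom (2^-1) (k - a).+1.
  apply/eqP; rewrite -addr_eq0 -[X in _ == X]e0 mulr2n.
  rewrite -addrA [X in _ + X]addrC; apply/eqP; congr (_ + (_ + _)).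
  apply: eq_bigr => a _; rewrite /bump /= !add1n subSS subSn //.
  by rewrite -ltnS.
rewrite catalan_gbinom exprS.
transitivity (- 4 * (-4) ^+ k * (gbinom (2^-1 : F) k.+2 *+ 2)).
  by rewrite mulr2n; ring.
rewrite e1 mulrN -mulNr mulr_sumr; apply: eq_bigr => a _.
have le_ak : (a <= k)%N by rewrite -ltnS.
by rewrite (expr_split _ le_ak) !catalan_gbinom; ring.
Qed.

(** Congruence modulo X^(m+1), the form in which identities of series survive truncation. *)
Definition eq_upto (R : nzRingType) m (p q : {poly R}) :=
  forall k, (k <= m)%N -> p`_k = q`_k.

Lemma eq_uptoM (R : nzRingType) m (p p' q q' : {poly R}) :
  eq_upto m p p' -> eq_upto m q q' -> eq_upto m (p * q) (p' * q').
Proof.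
move=> pp qq k km; rewrite !coefM; apply: eq_bigr => i _.
by rewrite pp ?qq ?(leq_trans _ km) ?leq_subr // -ltnS.
Qed.

Lemma eq_uptoX (R : nzRingType) m i (p q : {poly R}) :
  eq_upto m p q -> eq_upto m (p ^+ i) (q ^+ i).
Proof. by move=> pq; elim: i => // i IH; rewrite !exprS; apply: eq_uptoM. Qed.

Lemma coefX_lt (R : nzRingType) (p : {poly R}) i k :
  p`_0 = 0 -> (k < i)%N -> (p ^+ i)`_k = 0.
Proof.
move=> p0; elim: i k => // i IH k lt_ki.
rewrite exprS coefM big_ord_recl p0 mul0r add0r big1 // => j _.
by rewrite /= IH ?mulr0 //= /bump add1n; case: k lt_ki j => [|k] ? []//= *;
  rewrite subSS (leq_ltn_trans (leq_subr _ _)).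
Qed.

(** Powers [q ^+ i] with i > m start above degree [m], and coefficients of [p] beyond its size are
    0. Hence both ranges of summation extend to their maximum. *)
Lemma coef_comp_poly_upto (R : nzRingType) (p q : {poly R}) m :
  q`_0 = 0 -> (p \Po q)`_m = \sum_(i < m.+1) p`_i * (q ^+ i)`_m.
Proof.
move=> q0; rewrite coef_comp_poly.
pose f i := p`_i * (q ^+ i)`_m.
rewrite -(big_mkord xpredT f) -[RHS](big_mkord xpredT f).
have ext N : (size p <= N)%N ->
    \sum_(0 <= i < size p) f i = \sum_(0 <= i < N) f i.
  move=> le_pN; rewrite (big_cat_nat _ le_pN) //= [X in _ + X]big_nat_cond.
  rewrite [X in _ + X]big1 ?addr0 // => i /andP[/andP[le_pi _] _].
  by rewrite /f nth_default ?mul0r.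
rewrite (ext (maxn (size p) m.+1)) ?leq_maxl //.
rewrite (@big_cat_nat _ _ _ m.+1) ?leq_maxr //= [X in _ + X]big_nat_cond.
rewrite [X in _ + X]big1 ?addr0 // => i /andP[/andP[lt_mi _] _].
by rewrite /f coefX_lt ?mulr0.
Qed.

Lemma eq_upto_comp (R : nzRingType) (p p' q : {poly R}) m :
  q`_0 = 0 -> eq_upto m p p' -> eq_upto m (p \Po q) (p' \Po q).
Proof.
move=> q0 pp k km; rewrite !coef_comp_poly_upto //; apply: eq_bigr => i _.
by rewrite pp // (leq_trans _ km) // -ltnS.
Qed.

Definition catalan_poly (F : fieldType) m : {poly F} :=
  \poly_(k < m.+1) catalan0 F k.

Lemma catalan_poly0 (F : fieldType) m : (catalan_poly F m)`_0 = 0.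
Proof. by rewrite coef_poly. Qed.

(** Expanding the power by distributivity gives one monomial per family of exponents. The truncation
    loses nothing, as exponents summing to [m] are at most [m]. *)
Lemma coef_catalan_polyX (F : fieldType) i m :
  (catalan_poly F m ^+ i)`_m = catalan0_conv F i m.
Proof.
rewrite -[in LHS](card_ord i) -prodr_const /catalan_poly poly_def.
rewrite bigA_distr_bigA coef_sum /catalan0_conv [RHS]big_mkcond /=.
apply: eq_bigr => f _.
under eq_bigr do rewrite -mul_polyC.
rewrite big_split /= -rmorph_prod mul_polyC coefZ prodrXr coefXn eq_sym.
by case: eqP => _; rewrite ?mulr1 ?mulr0.
Qed.

(** Since C_0 = 1, adding 1 restores the full Catalan series C up to degree [m], and [catalanS]
    reads C = 1 + u C^2. *)
Lemma catalan_poly_eq (F : numFieldType) m :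
  eq_upto m (catalan_poly F m) ('X * (1 + catalan_poly F m) ^+ 2).
Proof.
have coef1D k : (k <= m)%N -> (1 + catalan_poly F m)`_k = catalan F k.
  move=> km; rewrite coefD coef1 coef_poly ltnS km /catalan0.
  case: k km => [|k] _; last by rewrite add0r.
  by rewrite addr0 /catalan muln0 bin0 invr1 mulr1.
move=> [|k] lt_km; first by rewrite catalan_poly0 coefXM.
rewrite coefXM /= coef_poly ltnS lt_km /catalan0 /= catalanS expr2 coefM.
apply: eq_bigr => a _; rewrite !coef1D //.
  by rewrite (leq_trans (leq_subr _ _)) // ltnW.
by rewrite (leq_trans _ (ltnW lt_km)) // -ltnS.
Qed.

Lemma coef_exp1DX (R : nzRingType) n k :
  ((1 + 'X : {poly R}) ^+ n)`_k = 'C(n, k)%:R.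
Proof.
elim: n k => [|n IH] [|k]; rewrite ?coef1 //= exprS mulrDl mul1r coefD coefXM /=.
  by rewrite addr0 IH !bin0.
by rewrite !IH binS natrD.
Qed.

(** The degree bound on [g] gives 2i <= n, so (1+t)^n absorbs every denominator (1+t)^(2i); the
    identity then descends from fractions to polynomials because [tofrac] is injective. *)
Lemma gamma_poly_expansion (F : fieldType) n (h g : {poly F}) :
  is_gamma_poly n h g ->
  h = \sum_(i < (n %/ 2).+1) g`_i *: ('X ^+ i * (1 + 'X) ^+ (n - 2 * i)).
Proof.
case=> size_g hg; apply/eqP; rewrite -tofrac_eq hg; apply/eqP.
have X1 : tofrac (1 + 'X : {poly F}) != 0.
  by rewrite tofrac_eq0 -size_poly_eq0 addrC -polyC1 size_XaddC.
rewrite (@horner_coef_wide _ (n %/ 2).+1); last first.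
  by apply: leq_trans size_g; rewrite size_poly.
rewrite mulr_sumr rmorph_sum /=; apply: eq_bigr => i _.
have le_in : (2 * i <= n)%N by rewrite mulnC -leq_divRL // -ltnS.
rewrite coef_map_id0 ?tofrac0 // -mul_polyC !rmorphM /= !rmorphXn /=.
rewrite exprMn exprVn -exprM (expr_split _ le_in).
have X1i : tofrac (1 + 'X : {poly F}) ^+ (2 * i) != 0 by rewrite expf_neq0.
by rewrite mulrCA; congr (_ * _); rewrite mulrC mulrA divfK.
Qed.

Lemma coef_gamma_poly (F : numFieldType) n (h g : {poly F}) m :
  is_gamma_poly n h g ->
  g`_m = \sum_(i < m.+1) \sum_(l < i.+1)
           h`_l * gbinom (- n%:R) (i - l) * catalan0_conv F i m.
Proof.
move=> hg; pose P := catalan_poly F m.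
(* [B] is the binomial series of (1+t)^(-n), cut after degree [m]. *)
pose B : {poly F} := \poly_(k < m.+1) gbinom (- n%:R) k.
(* Substituting t = P turns the i-th term of the expansion into P^i (1+P)^(n-2i); as P^i agrees with
   u^i (1+P)^(2i) up to degree [m], the powers of 1+P combine to exponent n. *)
have hP : eq_upto m (h \Po P) (g * (1 + P) ^+ n).
  have -> : g = \sum_(i < (n %/ 2).+1) g`_i *: 'X^i.
    rewrite -poly_def; apply/polyP => k; rewrite coef_poly.
    case: ltnP => // le_k; rewrite nth_default //.
    by case: hg => size_g _; apply: leq_trans le_k.
  rewrite [in h \Po P](gamma_poly_expansion hg) => k km.
  rewrite linear_sum mulr_suml /= !coef_sum; apply: eq_bigr => i _.
  rewrite comp_polyZ -scalerAl !coefZ; congr (_ * _).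
  rewrite comp_polyM !rmorphXn /= comp_polyD comp_polyX comp_polyC.
  have le_in : (2 * i <= n)%N by rewrite mulnC -leq_divRL // -ltnS.
  rewrite (expr_split _ le_in) mulrA.
  apply: (eq_uptoM _ _ km) => //.
  by rewrite exprM -exprMn; apply/eq_uptoX/catalan_poly_eq.
(* Vandermonde at n + (-n) = 0. *)
have BX : eq_upto m ((1 + 'X) ^+ n * B) 1.
  move=> k km; rewrite coefM.
  transitivity (gbinom (n%:R - n%:R : F) k).
    rewrite gbinomD; apply: eq_bigr => a _.
    by rewrite coef_poly ltnS (leq_trans (leq_subr _ _) km) gbinom_nat coef_exp1DX.
  by rewrite subrr (gbinom_nat _ 0) bin0n coef1.
(* Multiply [g] by (1+P)^n B(P), which is 1 up to degree [m], and regroup g (1+P)^n into h(P) by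
   [hP]. *)
have -> : g`_m = ((h * B) \Po P)`_m.
  have g1 : eq_upto m g (g * (((1 + 'X) ^+ n * B) \Po P)).
    rewrite -[X in eq_upto m X]mulr1; apply: eq_uptoM => // k km.
    rewrite -[1 in LHS](comp_polyC 1 P).
    by apply/esym/(eq_upto_comp _ _ km) => //; apply: catalan_poly0.
  rewrite g1 // !comp_polyM rmorphXn /= comp_polyD comp_polyX comp_polyC.
  by rewrite mulrA; apply: (eq_uptoM _ _ (leqnn m)) => // k km; rewrite hP.
rewrite coef_comp_poly_upto ?catalan_poly0 //; apply: eq_bigr => i _.
rewrite coef_catalan_polyX coefM mulr_suml; apply: eq_bigr => l _.
rewrite coef_poly ltnS (leq_trans (leq_subr _ _)) //.
by rewrite -ltnS.
Qed.

Theorem theorem1p1 (F : numFieldType) (n : nat) (h g : {poly F})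
    (h_reciprocal : reciprocal n h) (g_gamma : is_gamma_poly n h g) (m : nat) :
  [/\ g`_m =
        \sum_(i < m.+1) \sum_(l < i.+1)
          h`_l * gbinom (- n%:R) (i - l) * catalan0_conv F i m,
      \sum_(i < m.+1) \sum_(l < i.+1)
          h`_l * gbinom (- n%:R) (i - l) * catalan0_conv F i m =
        \sum_(i < m.+1) \sum_(l < i.+1)
          h`_l * (-1) ^+ (i - l) *
          gbinom (n%:R + i%:R - l%:R - 1) (i - l) * catalan0_conv F i m
    & (n %/ 2 < m)%N ->
        \sum_(i < m.+1) \sum_(l < i.+1)
          h`_l * gbinom (- n%:R) (i - l) * catalan0_conv F i m = 0].
Proof.
split; first exact: coef_gamma_poly.
- apply: eq_bigr => i _; apply: eq_bigr => l _.
  by rewrite gbinomN natrB -1?ltnS // !mulrA addrA.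
(* The sum is a coefficient of [g] past its degree bound, where the default value is 0. *)
- move=> lt_nm; rewrite -(coef_gamma_poly m g_gamma) nth_default //.
  by case: g_gamma => size_g _; apply: leq_trans lt_nm.
Qed.
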